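(* Let $k\ge 1$ be an integer, let $\lambda_1,\dots,\lambda_k>0$, and let $\{M(t)\}_{t\ge0}$ be the generalized counting process (GCP) with rates $\lambda_1,\dots,\lambda_k$. Then the process $\left\{M(t)-\sum_{j=1}^{k}j\lambda_{j}t\right\}_{t\geq0}$ is a martingale with respect to the natural filtration $\mathscr{F}_{t}=\sigma\left(M(s),\, s\le t\right)$, $t\ge 0$.
   Context: The generalized counting process (GCP) $\{M(t)\}_{t\ge0}$ with rates $\lambda_1,\dots,\lambda_k>0$ is the counting process started at $0$ performing jumps of sizes $1,\dots,k$ with rates $\lambda_1,\dots,\lambda_k$ respectively. It is a compound Poisson process (in particular a Lévy process, with independent and stationary increments): $M(t)\overset{d}{=}\sum_{i=1}^{N(t)}X_i$, where $\{N(t)\}_{t\ge0}$ is a Poisson process with intensity $\Lambda=\lambda_1+\dots+\lambda_k$ independent of the iid sequence $\{X_i\}_{i\ge1}$ with $\mathrm{Pr}\{X_1=j\}=\lambda_j/\Lambda$, $j=1,\dots,k$. *)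

(* Defs.v *)
From HB Require Import structures.
From mathcomp Require Import all_boot all_order all_algebra finmap.
From mathcomp Require Import all_classical all_reals all_analysis.

Set Implicit Arguments.
Unset Strict Implicit.
Unset Printing Implicit Defensive.

Import Order.TTheory GRing.Theory Num.Theory.
Import numFieldNormedType.Exports.

Local Open Scope classical_set_scope.
Local Open Scope ring_scope.

Section sigma_algebras.
Context {d d' : measure_display} {T : measurableType d} {T' : measurableType d'}.

Definition sigma_of {I : Type} (D : set I) (X : I -> T -> T') : set (set T) :=
  <<s \bigcup_(i in D) preimage_set_system [set: T] (X i) measurable >>.

Definition natural_filtration {o : Order.disp_t} {I : porderType o}
    (X : I -> T -> T') (t : I) : set (set T) :=
  sigma_of [set s | (s <= t)%O] X.

End sigma_algebras.

Section independence.
Context {R : realType} {d : measure_display} {T : measurableType d}.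
Variable P : probability T R.
Local Open Scope ereal_scope.

Definition independent2 (F G : set (set T)) : Prop :=
  forall A B, F A -> G B -> P (A `&` B) = P A * P B.

Definition mutually_independent {I : choiceType} (F : I -> set (set T)) : Prop :=
  forall (J : {fset I}) (E : I -> set T), (forall i, i \in J -> F i (E i)) ->
    P (\bigcap_(i in [set` J]) E i) = \prod_(i <- J) P (E i).

End independence.

Section martingale.
Context {R : realType} {d : measure_display} {T : measurableType d}.
Variable P : probability T R.

(* [Y] is a version of the conditional expectation of the integrable variable
   [X] given the sub-sigma-algebra [G]. *)
Definition is_cond_expectation (G : set (set T)) (X Y : T -> R) : Prop :=
  [/\ forall B : set R, measurable B -> G (Y @^-1` B),
      P.-integrable [set: T] (EFin \o Y) &
      forall A, G A -> (\int[P]_(w in A) (Y w)%:E = \int[P]_(w in A) (X w)%:E)%E].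

Context {o : Order.disp_t} {I : porderType o}.

Definition filtration (F : I -> set (set T)) : Prop :=
  [/\ forall t, sigma_algebra [set: T] (F t),
      forall t, F t `<=` measurable &
      forall s t, (s <= t)%O -> F s `<=` F t].

Definition martingale (F : I -> set (set T)) (X : I -> T -> R) : Prop :=
  [/\ filtration F,
      forall t (B : set R), measurable B -> F t (X t @^-1` B),
      forall t, P.-integrable [set: T] (EFin \o X t) &
      forall s t, (s <= t)%O -> is_cond_expectation (F s) (X t) (X s)].

End martingale.

Section counting_processes.
Context {R : realType} {d : measure_display} {T : measurableType d}.
Variable P : probability T R.
Implicit Type N : {nonneg R} -> {RV P >-> nat}.

Definition counting_path (x : {nonneg R} -> nat) : Prop :=
  [/\ x 0%:nng = 0%N,
      forall s t, s <= t -> (x s <= x t)%N &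
      forall t, exists2 e : R, 0 < e &
        forall s, t <= s -> s%:num < t%:num + e -> x s = x t].

Definition counting_process N : Prop :=
  {ae P, forall w, counting_path (fun t => N t w)}.

(* Increments are taken in [R], as subtraction on [nat] is truncated. *)
Definition increment N (s t : {nonneg R}) : T -> R :=
  fun w => (N t w)%:R - (N s w)%:R.

Definition independent_increments N : Prop :=
  forall t : nat -> {nonneg R}, (forall n, t n <= t n.+1) ->
    mutually_independent P (fun n =>
      preimage_set_system [set: T] (increment N (t n) (t n.+1)) measurable).

Definition stationary_increments N : Prop :=
  forall (s h : {nonneg R}) (B : set R), measurable B ->
    P (increment N s (s%:num + h%:num)%:nng @^-1` B) =
    P (increment N 0%:nng h @^-1` B).

(* The law of the increments is stated for [s < t] only, since
   [poisson_pmf 0] is not the Poisson distribution of parameter 0. *)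
Definition poisson_process (rate : R) N : Prop :=
  [/\ counting_process N, independent_increments N &
      forall (s t : {nonneg R}) (n : nat), s < t ->
        P (increment N s t @^-1` [set n%:R]) =
        (poisson_pmf (rate * (t%:num - s%:num)) n)%:E].

End counting_processes.

Section generalized_counting_process.
Context {R : realType} {k : nat}.
(* [lambda j] is the rate of the jumps of size [j.+1]. *)
Variable lambda : 'I_k -> R.

Definition total_rate : R := \sum_(j < k) lambda j.

Definition compound_poisson_data {d : measure_display} {T : measurableType d}
    (P : probability T R) (N : {nonneg R} -> {RV P >-> nat})
    (X : nat -> {RV P >-> nat}) : Prop :=
  [/\ poisson_process total_rate N,
      mutually_independent P
        (fun i => preimage_set_system [set: T] (X i) measurable),
      forall i (j : 'I_k), P (X i @^-1` [set j.+1]) = (lambda j / total_rate)%:E &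
      independent2 P (sigma_of [set: {nonneg R}] N) (sigma_of [set: nat] X)].

(* A Levy counting process such that, for each [t], [M t] is equal in
   distribution to the sum of the [X i] for [i < N t]; the compound Poisson
   variables may live on another probability space. *)
Definition generalized_counting_process {d : measure_display}
    {T : measurableType d} (P : probability T R)
    (M : {nonneg R} -> {RV P >-> nat}) : Prop :=
  [/\ counting_process M, independent_increments M, stationary_increments M &
      exists (d' : measure_display) (T' : measurableType d')
        (P' : probability T' R) (N : {nonneg R} -> {RV P' >-> nat})
        (X : nat -> {RV P' >-> nat}),
        compound_poisson_data N X /\
        forall (t : {nonneg R}) (A : set nat),
          P (M t @^-1` A) =
          P' ((fun w => (\sum_(i < N t w) X i w)%N) @^-1` A)].

End generalized_counting_process.

(* Main.v *)
Require Import Defs.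
From HB Require Import structures.
From mathcomp Require Import all_boot all_order all_algebra finmap.
From mathcomp Require Import all_classical all_reals all_analysis measurable_realfun.
From mathcomp Require Import ring.

Set Implicit Arguments.
Unset Strict Implicit.
Unset Printing Implicit Defensive.

Import Order.TTheory GRing.Theory Num.Theory.
Import numFieldNormedType.Exports.

Local Open Scope classical_set_scope.
Local Open Scope ring_scope.

(** The compensated process is a martingale because the increment after time
[s] is independent of the past up to [s], so that conditioning on the past
replaces the increment by its mean, which is what the compensator subtracts.

The mean of [M t] is computed from the compound Poisson representation: only
the law of [M t] matters, so the mean is that of a sum of [N t] jumps. Wald's
identity [wald] gives the mean of [N t] (Poisson, hence the total rate times
[t]) times the mean of one jump, and the total rate cancels.

Independence of the increments from each other says nothing directly about
the sigma-algebra generated by the values [M u], [u <= s]. The link is made on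
cylinders, the events fixing the values of [M] at finitely many times. They
form a pi-system generating the past. Once the times are sorted, and since
[M] starts at 0 almost surely, fixing the values amounts to fixing the
successive increments; [cylinder_increment_indep] follows. Hence the integrals
of [M t] and of [M s] plus the mean increment agree on every cylinder. Both are
finite measures as functions of the event, so they agree on the whole past by
uniqueness of measures ([eq_integral_pi_system]). Working with these two
nonnegative functions, instead of the compensated process itself, keeps
everything within measures rather than signed charges. *)

(** * Integrals of functions with values in the natural numbers *)

Section nat_valued.
Context {R : realType} {d : measure_display} {T : measurableType d}.
Local Open Scope ereal_scope.
Implicit Types (A B : set T) (X : T -> nat).

Lemma measurable_preimage_nat X (B : set nat) :
  measurable_fun [set: T] X -> measurable (X @^-1` B).
Proof. by move=> mX; rewrite -[_ @^-1` _]setTI; exact: mX. Qed.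

Lemma measurable_natr X A :
  measurable_fun [set: T] X -> measurable_fun A ((fun w => (X w)%:R%:E) : T -> \bar R).
Proof.
move=> mX; apply: measurable_funTS; apply/measurable_EFinP.
by apply: (measurableT_comp _ mX).
Qed.

Lemma ae_iff_measure (mu : {measure set T -> \bar R}) A B :
  measurable A -> measurable B -> {ae mu, forall w, A w <-> B w} ->
  mu A = mu B.
Proof.
move=> mA mB AB; rewrite -[A]setIT -[B]setIT -!integral_indic//.
apply: ge0_ae_eq_integral => //.
- by apply/measurable_EFinP; exact: measurable_indic.
- by apply/measurable_EFinP; exact: measurable_indic.
- apply: filterS AB => w /propext AB _; congr EFin.
  rewrite !indicE; congr (_%:R).
  by rewrite (_ : (w \in A) = (w \in B))// /in_mem/= /in_set AB.
Qed.

(** The integral only depends on the measures of the level sets; this is how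
identities between laws and product rules are turned into identities between
integrals. *)
Lemma integral_nat_levels (mu : {measure set T -> \bar R}) X A :
  measurable_fun [set: T] X -> measurable A ->
  \int[mu]_(w in A) (X w)%:R%:E =
  \sum_(n <oo) n%:R%:E * mu (A `&` X @^-1` [set n]).
Proof.
move=> mX mA.
have mAX n : measurable (A `&` X @^-1` [set n]).
  by apply: measurableI => //; exact: measurable_preimage_nat.
have AE : A = \bigcup_n (A `&` X @^-1` [set n]).
  by apply/seteqP; split=> [w Aw|w [n _ []//]]; exists (X w).
rewrite [in LHS]AE ge0_integral_bigcup//.
- apply: eq_eseriesr => n _.
  rewrite -integral_cst//; apply: eq_integral => w; rewrite inE => -[_ /= ->].
  by [].
- exact: measurable_natr.
- by apply/trivIsetP => i j _ _ ij; apply/seteqP; split=> // w [[_ /= Xi] [_ /= Xj]];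
  case/eqP: ij; rewrite -Xi.
Qed.

(** Tonelli: the [i]-th term contributes exactly on the event that the random
number of terms exceeds [i]. *)
Lemma integral_sum_stopped (mu : {measure set T -> \bar R})
    (N : T -> nat) (X : nat -> T -> nat) :
  measurable_fun [set: T] N -> (forall i, measurable_fun [set: T] (X i)) ->
  \int[mu]_w ((\sum_(i < N w) X i w)%N)%:R%:E =
  \sum_(i <oo) \int[mu]_(w in N @^-1` [set n | (i < n)%N]) (X i w)%:R%:E.
Proof.
move=> mN mX.
have mNi i : measurable (N @^-1` [set n | (i < n)%N]).
  exact: measurable_preimage_nat.
under eq_eseriesr => i _ do rewrite (integral_mkcond _ (fun w => (X i w)%:R%:E)).
rewrite -integral_nneseries//; last 2 first.
- by move=> i; apply/(measurable_restrictT _ _).1 => //; exact: measurable_natr.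
- by move=> i w _; rewrite patchE; case: ifP.
apply: eq_integral => w _.
(* The terms from index [N w] on vanish at [w]. *)
rewrite (nneseries_split 0 (N w)); last first.
  by move=> i _; rewrite patchE; case: ifP.
rewrite add0n [X in _ + X]eseries0 ?adde0; last first.
  move=> i Ni _; rewrite patchE; case: ifPn => //; rewrite inE /=.
  by rewrite ltnNge Ni.
rewrite big_mkord (eq_bigr (fun i : 'I_(N w) => (X i w)%:R%:E)); last first.
  by move=> i _; rewrite patchE mem_set//=; exact: ltn_ord.
by rewrite sumEFin natr_sum.
Qed.

End nat_valued.

Section nat_valued_probability.
Context {R : realType} {d : measure_display} {T : measurableType d}.
Variable P : probability T R.
Local Open Scope ereal_scope.

Lemma integral_indep_nat (X : T -> nat) (A : set T) :
  measurable_fun [set: T] X -> measurable A ->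
  (forall n, P (A `&` X @^-1` [set n]) = P A * P (X @^-1` [set n])) ->
  \int[P]_(w in A) (X w)%:R%:E = P A * \int[P]_w (X w)%:R%:E.
Proof.
move=> mX mA AX; rewrite !integral_nat_levels//.
rewrite -(fineK (fin_num_measure P _ mA)) -nneseriesZl//.
apply: eq_eseriesr => n _; rewrite fineK ?fin_num_measure// setTI muleCA.
by congr *%E; exact: AX.
Qed.

(** Wald's identity. The [i]-th term counts when [i < N], an event independent
of [X i], so it contributes [m] times the probability of that event; these
probabilities add up to the mean of [N], as [N] is itself a stopped sum of
ones. *)
Lemma wald (N : T -> nat) (X : nat -> T -> nat) (m : R) :
  measurable_fun [set: T] N -> (forall i, measurable_fun [set: T] (X i)) ->
  (forall i n, P (N @^-1` [set j | (i < j)%N] `&` X i @^-1` [set n]) =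
               P (N @^-1` [set j | (i < j)%N]) * P (X i @^-1` [set n])) ->
  (forall i, \int[P]_w (X i w)%:R%:E = m%:E) ->
  \int[P]_w ((\sum_(i < N w) X i w)%N)%:R%:E = m%:E * \int[P]_w (N w)%:R%:E.
Proof.
move=> mN mX NX EX.
rewrite integral_sum_stopped//.
have -> : \int[P]_w (N w)%:R%:E =
    \sum_(i <oo) P (N @^-1` [set j | (i < j)%N]) :> \bar R.
  under eq_integral => w _ do rewrite -[N w]card_ord -sum1_card.
  rewrite (@integral_sum_stopped _ _ _ P N (fun _ _ => 1%N))//.
  apply: eq_eseriesr => i _.
  by rewrite integral_cst ?mul1e//; exact: measurable_preimage_nat.
rewrite -nneseriesZl//; apply: eq_eseriesr => i _.
by rewrite integral_indep_nat ?EX 1?muleC//; exact: measurable_preimage_nat.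
Qed.

End nat_valued_probability.

(** * The mean of the generalized counting process *)

(** The factor [n] cancels in the factorial: the terms are those of the total
mass, shifted by one and multiplied by [r]. *)
Lemma poisson_mean {R : realType} (r : R) : 0 < r ->
  (\sum_(n <oo) n%:R%:E * (poisson_pmf r n)%:E = r%:E)%E.
Proof.
move=> r0; rewrite nneseries_recl//; last first.
  by move=> n _; rewrite mule_ge0// lee_fin poisson_pmf_ge0.
rewrite mul0e add0e -(nneseries_addn 1)/=; last first.
  by move=> n; rewrite mule_ge0// lee_fin poisson_pmf_ge0.
have step n : ((n + 1)%N%:R%:E * (poisson_pmf r (n + 1))%:E =
               r%:E * (poisson_pmf r n)%:E)%E.
  rewrite -!EFinM /poisson_pmf r0 addn1; congr EFin.
  have : n.+1%:R != 0 :> R by rewrite pnatr_eq0.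
  have : n`!%:R != 0 :> R by rewrite pnatr_eq0 -lt0n fact_gt0.
  rewrite factS natrM exprS.
  move: (n.+1%:R) (n`!%:R) (r ^+ n) => a f e f0 a0.
  by field; apply/andP.
under eq_eseriesr do rewrite step.
rewrite nneseriesZl; last by move=> n _; rewrite lee_fin poisson_pmf_ge0.
have := probability_setT (poisson_prob r 0).
rewrite /= /poisson_prob r0 -nneseries_esumT => [->|n]; first by rewrite mule1.
by rewrite lee_fin poisson_pmf_ge0.
Qed.

Lemma measurable_stopped_sum {d : measure_display} {T : measurableType d}
    (N : T -> nat) (X : nat -> T -> nat) :
  measurable_fun [set: T] N -> (forall i, measurable_fun [set: T] (X i)) ->
  measurable_fun [set: T] (fun w => \sum_(i < N w) X i w)%N.
Proof.
move=> mN mX _ B mB; rewrite setTI.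
have mS n : measurable_fun [set: T] (fun w => \sum_(i < n) X i w)%N.
  elim: n => [|n IH].
    rewrite (_ : (fun _ => _) = fun=> 0%N); first exact: measurable_cst.
    by apply/funext => w; rewrite big_ord0.
  under eq_fun do rewrite big_ord_recr/=.
  exact: measurable_fun_addn.
rewrite (_ : _ @^-1` B = \bigcup_n
    (N @^-1` [set n] `&` (fun w => \sum_(i < n) X i w)%N @^-1` B)).
  by apply: bigcupT_measurable => n; apply: measurableI; exact: measurable_preimage_nat.
apply/seteqP; split => [w Bw|w [n _ [/= <-]]//]; by exists (N w).
Qed.

Lemma sigma_of_preimage {d d' : measure_display} {T : measurableType d}
    {T' : measurableType d'} {I : Type} (D : set I) (X : I -> T -> T') i B :
  D i -> measurable B -> sigma_of D X (X i @^-1` B).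
Proof.
by move=> Di mB; apply: sub_gen_smallest; exists i => //; exists B; rewrite ?setTI.
Qed.

Lemma total_rate_gt0 {R : realType} {k : nat} (lambda : 'I_k -> R) :
  (1 <= k)%N -> (forall j, 0 < lambda j) -> 0 < total_rate lambda.
Proof.
case: k lambda => // k lambda _ lam0.
by rewrite /total_rate big_ord_recl ltr_wpDr ?sumr_ge0// => i _; exact: ltW.
Qed.

Section moments.
Context {R : realType} {d : measure_display} {T : measurableType d}.
Variable P : probability T R.

Lemma counting_process0 (N : {nonneg R} -> {RV P >-> nat}) :
  counting_process N -> {ae P, forall w, N 0%:nng w = 0%N}.
Proof. by apply: filterS => w []. Qed.

Lemma poisson_process_mean (rate : R) (N : {nonneg R} -> {RV P >-> nat}) t :
  0 < rate -> poisson_process rate N ->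
  (\int[P]_w (N t w)%:R%:E = (rate * t%:num)%:E)%E.
Proof.
move=> rate0 [cN _ pN]; have N0 := counting_process0 cN.
(* At time 0 there is no Poisson law to use, but the process vanishes a.s. *)
have [t0|] := ltP 0%:nng t; last first.
  move=> t0; have -> : t = 0%:nng by apply/le_anti; rewrite t0/= -num_le/=.
  rewrite /= mulr0 (ge0_ae_eq_integral (g := cst 0%E))//.
  - by rewrite integral_cst// mul0e.
  - exact: measurable_natr.
  - by move: N0; apply: filterS => w -> .
rewrite integral_nat_levels// -[RHS]poisson_mean ?mulr_gt0//.
apply: eq_eseriesr => n _; congr *%E.
have := pN 0%:nng t n t0; rewrite /= subr0 => <-; rewrite setTI.
apply: ae_iff_measure => //.
- by apply: measurable_preimage_nat.
- rewrite -[X in measurable X]setTI; apply: measurable_funB => //.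
    apply: (measurableT_comp _ (measurable_funPT (N t))) => //.
  apply: (measurableT_comp _ (measurable_funPT (N 0%:nng))) => //.
- move: N0; apply: filterS => w N0; rewrite /increment /= N0 subr0.
  by split=> [->//|/eqP]; rewrite eqr_nat => /eqP.
Qed.

(** The prescribed probabilities add up to 1, so no mass is left for values
outside [1], ..., [k], and the series over the levels is a finite sum. *)
Lemma jump_mean {k : nat} (lambda : 'I_k -> R) (X : T -> nat) :
  (1 <= k)%N -> (forall j, 0 < lambda j) -> measurable_fun [set: T] X ->
  (forall j : 'I_k, P (X @^-1` [set j.+1]) = (lambda j / total_rate lambda)%:E) ->
  (\int[P]_w (X w)%:R%:E =
   (\sum_(j < k) j.+1%:R * (lambda j / total_rate lambda))%:E)%E.
Proof.
move=> k1 lam0 mX PX.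
have rate0 : total_rate lambda != 0 by rewrite gt_eqF// total_rate_gt0.
pose A := \big[setU/set0]_(j < k) X @^-1` [set j.+1].
have mXn n : measurable (X @^-1` [set n]) by exact: measurable_preimage_nat.
have PA : P A = 1%E.
  rewrite [LHS](measure_bigsetU P (F := fun j => X @^-1` [set j.+1]))//.
    by rewrite (eq_bigr _ (fun j _ => PX j)) sumEFin -mulr_suml divff.
  apply/trivIsetP => i j _ _ ij; apply/seteqP; split=> // w /= [-> [ji]].
  by rewrite ji eqxx in ij.
have PX0 n : (n == 0)%N || (k < n)%N -> P (X @^-1` [set n]) = 0%E.
  move=> nk; apply/eqP; rewrite eq_le measure_ge0 andbT.
  have mA : measurable A by exact: bigsetU_measurable.
  have -> : 0%E = P (~` A) by rewrite probability_setC// PA subee.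
  apply: le_measure; rewrite ?inE//; first exact: measurableC.
  move=> w /= Xw; rewrite /A -(bigcup_mkord k (fun j => X @^-1` [set j.+1])).
  move=> [j /= jk]; rewrite Xw => nj.
  by move: nk; rewrite nj/= ltnNge jk.
rewrite integral_nat_levels// (nneseries_split 0 k.+1); last first.
  by move=> n _; exact: mule_ge0.
rewrite add0n [X in (_ + X)%E]eseries0 ?adde0; last first.
  by move=> n kn _; rewrite setTI [X in (_ * X)%E]PX0 ?mule0// kn orbT.
rewrite big_mkord big_ord_recl mul0e add0e -sumEFin; apply: eq_bigr => j _.
by rewrite setTI EFinM -PX.
Qed.

End moments.

Lemma compound_poisson_mean {R : realType} {d : measure_display}
    {T : measurableType d} (P : probability T R) {k : nat} (lambda : 'I_k -> R)
    (N : {nonneg R} -> {RV P >-> nat}) (X : nat -> {RV P >-> nat}) t :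
  (1 <= k)%N -> (forall j, 0 < lambda j) -> compound_poisson_data lambda N X ->
  (\int[P]_w ((\sum_(i < N t w) X i w)%N)%:R%:E =
   (\sum_(j < k) j.+1%:R * lambda j * t%:num)%:E)%E.
Proof.
move=> k1 lam0 [pN _ PX NX].
have rate0 := total_rate_gt0 k1 lam0.
rewrite (wald (N := N t) (X := fun i => X i)
  (m := \sum_(j < k) j.+1%:R * (lambda j / total_rate lambda)))//.
- rewrite (poisson_process_mean _ rate0 pN) -EFinM; congr EFin.
  rewrite mulr_suml; apply: eq_bigr => j _.
  by field; rewrite gt_eqF.
- by move=> i n; apply: NX; apply: sigma_of_preimage.
- by move=> i; exact: jump_mean.
Qed.

(** The compound Poisson variables live on a space of their own, so the
comparison goes through the level sets. *)
Lemma gcp_mean {R : realType} {d : measure_display}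
    {T : measurableType d} (P : probability T R) {k : nat} (lambda : 'I_k -> R)
    (M : {nonneg R} -> {RV P >-> nat}) t :
  (1 <= k)%N -> (forall j, 0 < lambda j) ->
  generalized_counting_process lambda M ->
  (\int[P]_w (M t w)%:R%:E =
   (\sum_(j < k) j.+1%:R * lambda j * t%:num)%:E)%E.
Proof.
move=> k1 lam0 [_ _ _ [d' [T' [P' [N [X [NX ME]]]]]]].
rewrite -(compound_poisson_mean t k1 lam0 NX) !integral_nat_levels//; last first.
  exact: (measurable_stopped_sum (X := fun i w => X i w)).
by apply: eq_eseriesr => n _; rewrite !setTI; congr *%E; exact: ME.
Qed.

(** * Cylinders generate the natural filtration *)

Section cylinder_sets.
Context {d : measure_display} {T : measurableType d}.
Context {o : Order.disp_t} {I : porderType o}.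
Variable M : I -> T -> nat.

(** A list of pairs (time, value), possibly with repeated times or in disorder:
intersection is then concatenation, and sorting the list preserves the
event. *)
Definition cylinder (z : seq (I * nat)) : set T :=
  [set w | all (fun p => M p.1 w == p.2) z].

Definition cylinders (t : I) : set (set T) :=
  [set cylinder z | z in [set z | all (fun p => (p.1 <= t)%O) z]].

Lemma cylinder_cons p z :
  cylinder (p :: z) = M p.1 @^-1` [set p.2] `&` cylinder z.
Proof.
by apply/seteqP; split => [w /andP[/eqP]|w [/= /eqP Mp Mz]]//; apply/andP.
Qed.

Lemma setI_closed_cylinders t : setI_closed (cylinders t).
Proof.
move=> _ _ [y yt <-] [z zt <-]; exists (y ++ z).
  by rewrite /= all_cat; apply/andP.
apply/seteqP; split => w; rewrite /cylinder /= all_cat; first by move/andP.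
by move=> ?; apply/andP.
Qed.

Hypothesis mM : forall t, measurable_fun [set: T] (M t).

Lemma measurable_cylinder z : measurable (cylinder z).
Proof.
elim: z => [|p z IH].
  by rewrite (_ : cylinder _ = setT)//; apply/seteqP; split.
by rewrite cylinder_cons; apply: measurableI => //; exact: measurable_preimage_nat.
Qed.

(** Fixing exact values suffices, as an event on [M s] is a countable union over
its possible values. *)
Lemma natural_filtration_cylinders t :
  natural_filtration M t `<=` <<s cylinders t >>.
Proof.
apply: smallest_sub; first exact: smallest_sigma_algebra.
move=> _ [s /= st] [B _ <-]; rewrite setTI.
rewrite (_ : M s @^-1` B = \bigcup_n (if n \in B then cylinder [:: (s, n)] else set0)).
  apply: (@sigma_algebra_bigcup _ _ (cylinders t)) => n.
  case: ifPn => _; last exact: sigma_algebra0.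
  by apply: sub_gen_smallest; exists [:: (s, n)] => //=; rewrite st.
apply/seteqP; split => [w Bw|w [n _]].
  by exists (M s w) => //; rewrite mem_set// /cylinder /= eqxx.
by case: ifPn => //; rewrite inE /cylinder /= andbT => Bn /eqP ->.
Qed.

Lemma filtration_natural_filtration : filtration (natural_filtration M).
Proof.
split=> [t|t|s t st].
- exact: smallest_sigma_algebra.
- apply: smallest_sub; first exact: sigma_algebra_measurable.
  by move=> _ [s _ [B mB <-]]; exact: mM.
- apply: smallest_sub; first exact: smallest_sigma_algebra.
  move=> _ [r /= rs [B mB <-]]; apply: sub_gen_smallest.
  by exists r; [exact: le_trans st|exists B].
Qed.

End cylinder_sets.

(** * Independence of an increment from the past *)

Lemma mutually_independent_setI {R : realType} {d : measure_display}
    {T : measurableType d} (P : probability T R) {I : choiceType}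
    (F : I -> set (set T)) (J : {fset I}) (E : I -> set T) a :
  mutually_independent P F -> (forall i, F i (E i)) -> a \notin J ->
  (P (\bigcap_(i in [set` J]) E i `&` E a) =
   P (\bigcap_(i in [set` J]) E i) * P (E a))%E.
Proof.
move=> indep FE aJ; rewrite [in RHS]indep// muleC.
rewrite -(big_fsetU1 _ (fun i => P (E i)) aJ) -indep//; congr (P _).
apply/seteqP; split => [w [EJ Ea] i /=|w Ew].
  by rewrite !inE => /orP[/eqP ->//|]; exact: EJ.
split => [i /= iJ|]; apply: Ew; rewrite /= !inE ?eqxx//.
by rewrite iJ orbT.
Qed.

(** Telescoping. The differences are taken in [R] because a truncated difference
would not determine the next value. *)
Lemma eq_increments {R : realType} (f g : nat -> nat) n : f 0%N = g 0%N ->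
  (forall i, (i < n)%N -> f i.+1 = g i.+1) <->
  (forall i, (i < n)%N ->
     (f i.+1)%:R - (f i)%:R = (g i.+1)%:R - (g i)%:R :> R).
Proof.
move=> fg0; split=> [fg i ilt|fg].
  by rewrite fg//; case: i ilt => [|i] ilt; rewrite ?fg0// fg// ltnW.
elim=> [|i IH] ilt; have := fg _ ilt.
  by rewrite fg0 => /addIr /eqP; rewrite eqr_nat => /eqP.
by rewrite IH ?(ltnW ilt)// => /addIr /eqP; rewrite eqr_nat => /eqP.
Qed.

Section independence_of_the_past.
Context {R : realType} {d : measure_display} {T : measurableType d}.
Variables (P : probability T R) (M : {nonneg R} -> {RV P >-> nat}).
Hypotheses (cM : counting_process M) (iM : independent_increments M).

(* Naming the origin fixes its type, which lists of times need. *)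
Let time0 : {nonneg R} := 0%:nng.

Lemma measurable_increment s t : measurable_fun [set: T] (increment M s t).
Proof.
apply: measurable_funB.
  exact: (measurableT_comp _ (measurable_funPT (M t))).
exact: (measurableT_comp _ (measurable_funPT (M s))).
Qed.

Lemma measurable_preimage_increment s t (B : set R) :
  measurable B -> measurable (increment M s t @^-1` B).
Proof.
by move=> mB; rewrite -[X in measurable X]setTI; exact: measurable_increment.
Qed.

(** The times of [z] are sorted and completed by 0, [s] and [t]. Almost surely,
the cylinder is then an event on the increments between 0 and the last time of
[z], while the increment from [s] to [t] comes two steps later in the same
subdivision. The increment is truncated, which is harmless as [M] is almost
surely nondecreasing. *)
Lemma cylinder_increment_indep s t z m : s <= t ->
  all (fun p => p.1 <= s) z ->
  (P (cylinder M z `&` (fun w => M t w - M s w)%N @^-1` [set m]) =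
   P (cylinder M z) * P ((fun w => M t w - M s w)%N @^-1` [set m]))%E.
Proof.
move=> st zs.
pose r : rel ({nonneg R} * nat) := fun p q => p.1 <= q.1.
have rT : total r by move=> p q; exact: le_total.
pose z' := sort r z; pose p0 : {nonneg R} * nat := (time0, 0%N).
have -> : cylinder M z = cylinder M z'.
  by apply/funext => w; rewrite /cylinder/= all_sort.
have z's : all (fun p => p.1 <= s) z' by rewrite all_sort.
have z'_sorted : sorted r z' by exact: sort_sorted.
clearbody z'; clear z zs.
pose us := time0 :: map fst z' ++ [:: s; t].
pose tau n := nth t us n; pose n0 := size z'.
have us_sorted : sorted <=%O us.
  rewrite /us /= cat_path /=; apply/andP; split.
    rewrite path_sortedE; last exact: le_trans.
    rewrite sorted_map z'_sorted andbT; apply/allP => u _.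
    by rewrite -num_le/=.
  rewrite st !andbT.
  have : last time0 (map fst z') \in time0 :: map fst z' by exact: mem_last.
  rewrite inE => /orP[/eqP ->|]; first by rewrite -num_le/=.
  by move=> /mapP[p /(allP z's) ps ->].
(* Past the end of the list the default value makes [tau] constant, so it is
   nondecreasing on all of [nat]. *)
have tau_mono n : tau n <= tau n.+1.
  have [nlt|nge] := ltnP n.+1 (size us).
    exact: (sortedP t us_sorted).
  rewrite {2}/tau (nth_default _ nge) /tau.
  have [nlt|nge'] := ltnP n (size us); last by rewrite nth_default.
  have sz_us : size us = n.+1 by apply/eqP; rewrite eqn_leq nge nlt.
  have -> : n = (size us).-1 by rewrite sz_us.
  by rewrite nth_last /us /= last_cat.
pose v n := (nth p0 (p0 :: z') n).2.
have tauE n : (n <= n0)%N -> tau n = (nth p0 (p0 :: z') n).1.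
  case: n => // n nlt; rewrite /tau /= nth_cat size_map nlt.
  by rewrite (nth_map p0).
(* Below [n0], [E] holds the increments prescribed by [z]; at index [n0.+1] it
   is the event on the increment from [s] to [t]; the increment of index [n0],
   from the last time of [z] to [s], is left out of [J]. *)
pose E i := increment M (tau i) (tau i.+1) @^-1`
  [set if (i < n0)%N then (v i.+1)%:R - (v i)%:R else m%:R].
have tau_s : tau n0.+1 = s by rewrite /tau /= nth_cat size_map ltnn subnn.
have tau_t : tau n0.+2 = t.
  by rewrite /tau /= nth_cat size_map ltnNge leqnSn /= subSnn.
pose J := [fset i in iota 0 n0]%fset.
have mE i : measurable (E i) by exact: measurable_preimage_increment.
have mcap : measurable (\bigcap_(i in [set` J]) E i).
  by apply: fin_bigcap_measurable => [|i _]; [exact: finite_fset|exact: mE].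
have cyl_ae : {ae P, forall w, cylinder M z' w <-> (\bigcap_(i in [set` J]) E i) w}.
  move: (counting_process0 cM); apply: filterS => w M0.
  have vM0 : M (tau 0%N) w = v 0%N by rewrite /tau /= M0.
  have [vinc incv] := @eq_increments R (fun i => M (tau i) w) v n0 vM0.
  have capE : (\bigcap_(i in [set` J]) E i) w <->
      forall i, (i < n0)%N -> (M (tau i.+1) w)%:R - (M (tau i) w)%:R =
                              (v i.+1)%:R - (v i)%:R :> R.
    split=> [Ew i ilt|Ew i /=].
      by have := Ew i; rewrite /= !inE mem_iota /= add0n => /(_ ilt); rewrite /E /= ilt.
    by rewrite !inE mem_iota /= add0n => ilt; rewrite /E /= ilt; exact: Ew.
  rewrite capE; split => [Mz|inc].
    apply: vinc => i ilt; rewrite tauE//.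
    by apply/eqP; exact: (all_nthP p0 Mz).
  apply/(all_nthP p0) => i ilt; apply/eqP.
  by have := incv inc i ilt; rewrite tauE.
have inc_ae : {ae P, forall w,
    ((fun w => M t w - M s w)%N @^-1` [set m]) w <-> E n0.+1 w}.
  move: cM; apply: filterS => w [_ /(_ s t st) Mst _].
  rewrite /E /increment /= tau_s tau_t ltnNge leqnSn/= -natrB//.
  by split=> [->//|/eqP]; rewrite eqr_nat => /eqP.
have mD : measurable ((fun w => M t w - M s w)%N @^-1` [set m]).
  by apply: measurable_preimage_nat; exact: measurable_fun_subn.
have mC : measurable (cylinder M z') by exact: measurable_cylinder.
rewrite (ae_iff_measure mC mcap cyl_ae) (ae_iff_measure mD (mE _) inc_ae).
rewrite -(mutually_independent_setI (F := fun n =>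
  preimage_set_system [set: T] (increment M (tau n) (tau n.+1)) measurable)).
- apply: ae_iff_measure; [exact: measurableI|exact: measurableI|].
  by move: cyl_ae inc_ae; apply: filterS2 => w /= -> ->.
- exact: iM.
- by move=> i; exists [set if (i < n0)%N then (v i.+1)%:R - (v i)%:R else m%:R];
    rewrite ?setTI.
- by rewrite !inE mem_iota /= add0n ltnNge leqnSn.
Qed.

End independence_of_the_past.

(** * Comparing integrals on a pi-system *)

Section integral_pi_system.
Context {R : realType} {d : measure_display} {T : measurableType d}.
Variable mu : {measure set T -> \bar R}.
Local Open Scope ereal_scope.

(** The proofs [mf] and [f0] are arguments so that the measure structure declared
below can be inferred from the term. *)
Definition indefinite_integral (f : T -> \bar R)
    (mf : measurable_fun [set: T] f) (f0 : forall w, 0 <= f w) (A : set T) :=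
  \int[mu]_(w in A) f w.

Section measure.
Variable f : T -> \bar R.
Hypotheses (mf : measurable_fun [set: T] f) (f0 : forall w, 0 <= f w).

Let nu := indefinite_integral mf f0.

Let nu0 : nu set0 = 0. Proof. exact: integral_set0. Qed.

Let nu_ge0 A : 0 <= nu A. Proof. exact: integral_ge0. Qed.

Let nu_sigma_additive : semi_sigma_additive nu.
Proof. exact: semi_sigma_additive_nng_induced. Qed.

HB.instance Definition _ := isMeasure.Build _ _ _ (indefinite_integral mf f0)
  nu0 nu_ge0 nu_sigma_additive.

End measure.

Lemma eq_integral_pi_system (G : set (set T)) (f g : T -> \bar R) :
  G `<=` measurable -> setI_closed G -> G [set: T] ->
  measurable_fun [set: T] f -> measurable_fun [set: T] g ->
  (forall w, 0 <= f w) -> (forall w, 0 <= g w) ->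
  \int[mu]_w f w < +oo ->
  (forall A, G A -> \int[mu]_(w in A) f w = \int[mu]_(w in A) g w) ->
  forall A, <<s G >> A -> \int[mu]_(w in A) f w = \int[mu]_(w in A) g w.
Proof.
move=> Gm GI GT mf mg f0 g0 foo fg A GA.
apply: (g_sigma_algebra_measure_unique G Gm (fun=> [set: T]) (fun=> GT) _
  (indefinite_integral mf f0) (indefinite_integral mg g0)) => //.
by rewrite bigcup_const//; exists 0%N.
Qed.

End integral_pi_system.

(** * The martingale property *)

Section compensated_process.
Context {R : realType} {d : measure_display} {T : measurableType d}.
Variables (P : probability T R) (M : {nonneg R} -> {RV P >-> nat}) (c : R).
Hypotheses (cM : counting_process M) (iM : independent_increments M).
Hypothesis EM : forall t, (\int[P]_w (M t w)%:R%:E = (c * t%:num)%:E)%E.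
Hypothesis c0 : 0 <= c.

(** On a cylinder both sides differ from the integral of [M s] by the mean
increment times the probability of the cylinder; the pi-system argument then
reaches every event of the past. *)
Lemma past_integral s t A : s <= t -> natural_filtration M s A ->
  (\int[P]_(w in A) (M t w)%:R%:E =
   \int[P]_(w in A) ((M s w)%:R + c * (t%:num - s%:num))%:E)%E.
Proof.
move=> st /(natural_filtration_cylinders (M := fun t => M t)) FA.
have ts0 : 0 <= c * (t%:num - s%:num) by rewrite mulr_ge0// subr_ge0 num_le.
pose D w := (M t w - M s w)%N.
have mD : measurable_fun [set: T] D by exact: measurable_fun_subn.
have Mst : {ae P, forall w, (M s w <= M t w)%N}.
  by move: cM; apply: filterS => w [_ /(_ s t st)].
have split_int B : measurable B ->
    (\int[P]_(w in B) (M t w)%:R%:E =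
     \int[P]_(w in B) (M s w)%:R%:E + \int[P]_(w in B) (D w)%:R%:E)%E.
  move=> mB; rewrite -ge0_integralD//; try exact: measurable_natr.
  apply: ge0_ae_eq_integral => //; try exact: measurable_natr.
  - by apply: emeasurable_funD; exact: measurable_natr.
  - by move=> w _; exact: adde_ge0.
  - move: Mst; apply: filterS => w Mst _.
    by rewrite -EFinD -natrD subnKC.
have ED : (\int[P]_w (D w)%:R%:E = (c * (t%:num - s%:num))%:E)%E.
  have := split_int _ measurableT; rewrite !EM => Est.
  by rewrite mulrBr EFinB Est addeAC subee ?add0e.
move: A FA; apply: eq_integral_pi_system.
- by move=> _ [z _ <-]; exact: measurable_cylinder.
- exact: setI_closed_cylinders.
- by exists [::] => //; apply/seteqP; split.
- exact: measurable_natr.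
- apply/measurable_EFinP; apply: measurable_funD => //.
  exact: (measurableT_comp _ (measurable_funPT (M s))).
- by [].
- by move=> w; rewrite lee_fin addr_ge0.
- by rewrite EM ltry.
- move=> _ [z zs <-].
  have mz : measurable (cylinder M z) by exact: measurable_cylinder.
  rewrite split_int// (integral_indep_nat mD mz); last first.
    by move=> n; exact: cylinder_increment_indep.
  under [RHS]eq_integral do rewrite EFinD.
  rewrite ge0_integralD//; last exact: measurable_natr.
  by rewrite (integral_cst P mz (_%:E)) ED muleC.
Qed.

Lemma compensated_martingale :
  martingale P (natural_filtration M) (fun t w => (M t w)%:R - c * t%:num).
Proof.
have mM t : measurable_fun [set: T] (fun w => (M t w)%:R : R).
  exact: (measurableT_comp _ (measurable_funPT (M t))).
have intM t : P.-integrable [set: T] (fun w => (M t w)%:R%:E).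
  apply/integrableP; split; first exact/measurable_EFinP.
  under eq_integral do rewrite /= ger0_norm//.
  by rewrite EM ltry.
have intMc t : P.-integrable [set: T] (EFin \o (fun w => (M t w)%:R - c * t%:num)).
  rewrite (_ : _ \o _ = (fun w => (M t w)%:R%:E) \- cst (c * t%:num)%:E)%E//.
  by apply: integrableB => //; exact: finite_measure_integrable_cst.
have adapted t (B : set R) : measurable B ->
    natural_filtration M t ((fun w => (M t w)%:R - c * t%:num) @^-1` B).
  move=> mB; rewrite (_ : _ @^-1` B =
    M t @^-1` [set n | B (n%:R - c * t%:num)])//.
  by apply: sigma_of_preimage => //=.
have [sF mF incF] := filtration_natural_filtration (M := fun t => M t)
  (fun t => measurable_funPT (M t)).
split=> // s t st; split=> [B mB|//|A FA]; first exact: adapted.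
have mA : measurable A by exact: mF FA.
have intA u : P.-integrable A (fun w => (M u w)%:R%:E).
  exact: integrableS (intM u).
have intcst r : P.-integrable A (cst r%:E).
  exact: finite_measure_integrable_cst.
have := past_integral st FA.
under [X in _ = X -> _]eq_integral do rewrite EFinD.
under [X in _ -> X = _]eq_integral do rewrite EFinB.
under [X in _ -> _ = X]eq_integral do rewrite EFinB.
rewrite !integralB ?integralD//; try exact: intcst.
have icst r : (\int[P]_(w in A) r%:E = (r * fine (P A))%:E)%E.
  by rewrite (integral_cst P mA r%:E) EFinM fineK// fin_num_measure.
rewrite !icst => ->.
rewrite -(fineK (integrable_fin_num mA (intA s))).
by rewrite -EFinD -!EFinB; congr EFin; ring.
Qed.

End compensated_process.

Theorem proposition3p2 (R : realType) (d : measure_display)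
    (T : measurableType d) (P : probability T R) (k : nat)
    (lambda : 'I_k -> R) (M : {nonneg R} -> {RV P >-> nat})
    (k_ge1 : (1 <= k)%N) (lambda_gt0 : forall j, 0 < lambda j)
    (M_gcp : generalized_counting_process lambda M) :
  martingale P (natural_filtration M)
    (fun t w => (M t w)%:R - \sum_(j < k) j.+1%:R * lambda j * t%:num).
Proof.
rewrite (_ : (fun _ _ => _) = fun t w =>
    (M t w)%:R - (\sum_(j < k) j.+1%:R * lambda j) * t%:num); last first.
  by apply/funext => t; apply/funext => w; rewrite mulr_suml.
have [cM iM _ _] := M_gcp.
apply: compensated_martingale => // [t|].
  by rewrite (gcp_mean _ k_ge1 lambda_gt0 M_gcp) mulr_suml.
by apply: sumr_ge0 => j _; rewrite mulr_ge0// ltW.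
Qed.
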